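(* Let $p>2$ be a prime number, let $f(x)=x^4+ax^2+bx+c\in\mathbb{Z}[x]$ be irreducible, $\theta$ a root of $f(x)$ in an algebraic closure of $\mathbb{Q}$, and $K=\mathbb{Q}(\theta)$. Suppose that $f(x)$ factorizes modulo $p$ as the square of a quadratic irreducible polynomial; equivalently, $p\mid b$, $p\nmid ac$, $a^2\equiv 4c\pmod p$ and $-a/2$ is not a square modulo $p$. Let $s$ be any integer satisfying $v_p(a-2s)>\frac12 v_p(4c-a^2)$, and put $\nu=\frac12\min\{v_p(b),v_p(4c-a^2)\}\in\frac12\mathbb{Z}$. Then $$1,\quad \theta,\quad \frac{\theta^2+s}{p^{\lfloor\nu\rfloor}},\quad \frac{\theta^3+s\theta}{p^{\lfloor\nu\rfloor}}$$ is a $p$-integral basis of $K$.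
   Context: $v_p$ is the $p$-adic valuation, $v_p(0)=\infty$. A $p$-integral basis of $K$ is a family of elements of $K$ that is a $\mathbb{Z}_{(p)}$-basis of $\mathbb{Z}_K\otimes_{\mathbb{Z}}\mathbb{Z}_{(p)}$, where $\mathbb{Z}_K$ is the ring of integers of $K$ and $\mathbb{Z}_{(p)}$ the localization of $\mathbb{Z}$ at $p$. *)

(* Defs.v *)
From HB Require Import structures.
From mathcomp Require Import all_boot all_order all_algebra.
From mathcomp Require Import boolp classical_sets constructive_ereal.

Set Implicit Arguments.
Unset Strict Implicit.
Unset Printing Implicit Defensive.

Import Order.TTheory GRing.Theory Num.Theory.
Local Open Scope ring_scope.

(* The value group is embedded in \bar rat so that halves of valuations and
   the value +oo = v_p(0) are both available. *)
Definition vp (p : nat) (x : int) : \bar rat :=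
  if x == 0 then +oo%E else ((logn p `|x|%N)%:R)%:E.

Definition Zloc (p : nat) : {pred rat} := [pred r | ~~ (p %| `|denq r|)%N].

Definition quartic (a b c : int) : {poly int} :=
  'X^4 + a *: 'X^2 + b *: 'X + c%:P.

(* A field Omega together with iota : rat -> Omega is an algebraic closure of
   the rationals when Omega is algebraically closed (a closedFieldType) and
   algebraic over the image of iota. *)
Definition algebraic_over_rat (Omega : fieldType)
    (iota : {rmorphism rat -> Omega}) : Prop :=
  forall x : Omega, algebraicOver iota x.

(* Q(theta): any subfield of Omega contains the prime field, so this is the
   smallest subfield containing Q and theta. *)
Definition Qadjoin (Omega : fieldType) (theta : Omega) : set Omega :=
  smallest (fun S : set Omega => GRing.divring_closed (mem S))
    [set theta]%classic.

Definition ring_of_integers (Omega : fieldType) (K : set Omega) : set Omega :=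
  [set x | K x /\ integralOver (intr : int -> Omega) x]%classic.

(* The tensor product of Z_K with Z_(p) over Z, identified with its image in K
   under the (injective) multiplication map: finite sums of products r * z with
   r in Z_(p) and z in Z_K. *)
Definition localized_integers (Omega : fieldType)
    (iota : {rmorphism rat -> Omega}) (p : nat) (K : set Omega) : set Omega :=
  [set x | exists (n : nat) (r : 'I_n -> rat) (z : 'I_n -> Omega),
     [/\ forall i, r i \in Zloc p,
         forall i, ring_of_integers K (z i)
       & x = \sum_(i < n) iota (r i) * z i]]%classic.

Definition p_integral_basis (Omega : fieldType)
    (iota : {rmorphism rat -> Omega}) (p : nat) (K : set Omega) (n : nat)
    (e : n.-tuple Omega) : Prop :=
  [/\ forall i : 'I_n, localized_integers iota p K (tnth e i),
      forall x, localized_integers iota p K x ->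
        exists2 r : 'I_n -> rat, forall i, r i \in Zloc p &
          x = \sum_(i < n) iota (r i) * tnth e i
    & forall r : 'I_n -> rat, (forall i, r i \in Zloc p) ->
        \sum_(i < n) iota (r i) * tnth e i = 0 -> forall i, r i = 0].

(* Main.v *)
Require Import Defs.
From HB Require Import structures.
From mathcomp Require Import all_boot all_order all_algebra.
From mathcomp Require Import boolp classical_sets constructive_ereal.
From mathcomp Require Import ring zify.

(** Write [h = p ^ floor(nu)] and [z = (theta^2 + s) / h].  Completing the square
    in [f(theta) = 0] gives
      [theta^2 = h z - s]  and  [z^2 + A z + B theta + C = 0],
    where [A = (a - 2s)/h], [B = b/h^2] and [C = (s^2 - as + c)/h^2].  Since
    [4(s^2 - as + c) = (a - 2s)^2 + (4c - a^2)], and the hypothesis on [s] says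
    that the square has the larger valuation, the numbers [A], [B], [C] are
    integers, [p] divides [A], and one of two things happens
    ([order_parameters]):
    - unramified case ([2 nu] even): [p] divides [h], and not both of [B] and
      [C];
    - ramified case ([2 nu] odd): [p] divides [B] and [C], and [p^2] does not
      divide both.
    Hence the ring [O] with Z-basis [1, theta, z, theta z] consists of algebraic
    integers, and the point is that [O] is maximal at [p].

    If [u] in [O] and [u/p] is integral, an integral equation of [u/p], multiplied
    by a power of [p], shows that a power of [u] lies in [pO]
    ([integral_div_nilp]); so [u] is nilpotent in [O/pO].  As [-s = -a/2] is not
    a square modulo [p], the norm form [x^2 + s y^2] is anisotropic over F_p, that
    is, F_p[theta] with [theta^2 = -s] is a field with [p^2] elements.
    - In the unramified case [O/pO] is this field with a square root of the
      nonzero element [-(B theta + C)] adjoined; as [p] is odd it is reduced, and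
      [u] lies in [pO] ([quad_sqrn0]).
    - In the ramified case [O/(p, z)] is this field, so that [u = g z] modulo
      [pO], with [g] in [Z + Z theta].  Then [(g z / p)^2] is integral too.  It
      equals [- g^2 d / p], where [d = - z^2 / p = (A/p) z + (B/p) theta + C/p]
      is an element of [O] that is nonzero modulo [(p, z)].  Hence [g^2 d] is
      nilpotent modulo [p] as well and vanishes in the field [O/(p, z)], so that
      [g] lies in [pO] ([integral_div_ramified]).
    Iterating, [u / p^k] integral forces [u] to lie in [p^k O]
    ([integral_div_pexp]).  An element of [K] has rational coordinates on the
    basis ([Qadjoin_quad]); clearing denominators and applying the last statement
    shows that those of a [p]-integral element lie in Z_(p) ([localized_quad]).
    The freeness is the irreducibility of [f].

    The description of the factorization modulo [p] is a comparison of
    coefficients in [f = g^2], together with the fact that a quadratic polynomial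
    is irreducible when it has no root ([quartic_mod_square]). *)

Set Implicit Arguments.
Unset Strict Implicit.
Unset Printing Implicit Defensive.

Import Order.TTheory GRing.Theory Num.Theory.
Local Open Scope ring_scope.

(** * Quadruples of coordinates on 1, t, z, tz *)

Notation quad R := (R * R * R * R)%type.

Section QuadAlgebra.
Variables (R : comNzRingType) (h s A B C : R).

(** The product of [u0 + u1 t + u2 z + u3 t z] and [v0 + v1 t + v2 z + v3 t z]
    on the basis [1, t, z, t z], for [t^2 = h z - s] and
    [z^2 = - (A z + B t + C)]; [kij] is the coefficient of the product of the
    basis elements numbered [i] and [j], which is rewritten by these relations. *)
Definition quad_mul (u v : quad R) : quad R :=
  let: (u0, u1, u2, u3) := u in
  let: (v0, v1, v2, v3) := v in
  let k11 := u1 * v1 in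
  let k22 := u2 * v2 in
  let k13 := u1 * v3 + u3 * v1 in
  let k23 := u2 * v3 + u3 * v2 in
  let k33 := u3 * v3 in
  (u0 * v0 - s * k11 - C * k22 - h * C * k13 + s * B * k23
     + (h * A + s) * C * k33,
   u0 * v1 + u1 * v0 - B * k22 - h * B * k13 - C * k23
     + (h * A + s) * B * k33,
   u0 * v2 + u2 * v0 + h * k11 - A * k22 - (h * A + s) * k13 - h * B * k23
     + ((h * A + s) * A - h * C) * k33,
   u0 * v3 + u3 * v0 + u1 * v2 + u2 * v1 - A * k23 - h * B * k33).

(** Repeated squaring, giving the power of exponent [2 ^ n]: whether nonzero
    nilpotent elements exist is seen on squares alone. *)
Definition quad_sqrn (n : nat) : quad R -> quad R :=
  iter n (fun u => quad_mul u u).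

End QuadAlgebra.

Definition quad_map (R S : Type) (f : R -> S) (u : quad R) : quad S :=
  let: (u0, u1, u2, u3) := u in (f u0, f u1, f u2, f u3).

Definition quad_scale (R : comNzRingType) (k : R) : quad R -> quad R :=
  quad_map ( *%R k).

Definition quad_eval (R : comNzRingType) (K : fieldType) (f : R -> K) (t z : K)
    (u : quad R) : K :=
  let: (u0, u1, u2, u3) := u in f u0 + f u1 * t + f u2 * z + f u3 * (t * z).

(** The structure constants are polynomials in [h, s, A, B, C], so reduction
    modulo [p] is multiplicative. *)
Lemma quad_map_mul (R S : comNzRingType) (f : {rmorphism R -> S})
    (h s A B C : R) (u v : quad R) :
  quad_map f (quad_mul h s A B C u v) =
    quad_mul (f h) (f s) (f A) (f B) (f C) (quad_map f u) (quad_map f v).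
Proof.
case: u v => [[[u0 u1] u2] u3] [[[v0 v1] v2] v3] /=.
by rewrite !(rmorphD, rmorphN, rmorphM).
Qed.

Lemma quad_map_sqrn (R S : comNzRingType) (f : {rmorphism R -> S})
    (h s A B C : R) n (u : quad R) :
  quad_map f (quad_sqrn h s A B C n u) =
    quad_sqrn (f h) (f s) (f A) (f B) (f C) n (quad_map f u).
Proof. by elim: n => //= n IHn; rewrite quad_map_mul IHn. Qed.

Section QuadEval.
Variables (R : comNzRingType) (K : fieldType) (f : {rmorphism R -> K}).
Variables (t z : K).
Notation ev := (quad_eval f t z).

Lemma quad_eval_scale k u : ev (quad_scale k u) = f k * ev u.
Proof. by case: u => [[[u0 u1] u2] u3] /=; rewrite !rmorphM; ring. Qed.

Variables (h s A B C : R).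
Hypothesis t2E : t ^+ 2 = f h * z - f s.
Hypothesis z2E : z ^+ 2 = - (f A * z + f B * t + f C).

Lemma quad_eval_mul u v : ev (quad_mul h s A B C u v) = ev u * ev v.
Proof.
case: u v => [[[u0 u1] u2] u3] [[[v0 v1] v2] v3] /=.
rewrite !(rmorphD, rmorphN, rmorphM).
set H := f h; set S := f s; set a := f A; set b := f B; set c := f C.
have t2z : t ^+ 2 * z = - (H * c) - H * b * t - (H * a + S) * z.
  transitivity (H * z ^+ 2 - S * z); first by rewrite t2E -/H -/S; ring.
  by rewrite z2E -/a -/b -/c; ring.
have tz2 : t * z ^+ 2 = S * b - c * t - H * b * z - a * (t * z).
  rewrite z2E -/a -/b -/c.
  transitivity (- (a * (t * z) + b * t ^+ 2 + c * t)); first by ring.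
  by rewrite t2E -/H -/S; ring.
have t2z2 : t ^+ 2 * z ^+ 2 = (H * a + S) * c + (H * a + S) * b * t
    + ((H * a + S) * a - H * c) * z - H * b * (t * z).
  transitivity (t ^+ 2 * z * z); first by ring.
  rewrite t2z.
  transitivity (- (H * c * z) - H * b * (t * z) - (H * a + S) * z ^+ 2).
    by ring.
  by rewrite z2E -/a -/b -/c; ring.
move: t2E z2E; rewrite -/H -/S -/a -/b -/c => t2 z2.
transitivity (f u0 * f v0 + (f u0 * f v1 + f u1 * f v0) * t
  + (f u0 * f v2 + f u2 * f v0) * z
  + (f u0 * f v3 + f u3 * f v0 + f u1 * f v2 + f u2 * f v1) * (t * z)
  + f u1 * f v1 * t ^+ 2 + f u2 * f v2 * z ^+ 2
  + (f u1 * f v3 + f u3 * f v1) * (t ^+ 2 * z)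
  + (f u2 * f v3 + f u3 * f v2) * (t * z ^+ 2)
  + f u3 * f v3 * (t ^+ 2 * z ^+ 2)); last by ring.
by rewrite t2z2 t2z tz2 t2 z2; ring.
Qed.

Lemma quad_eval_sqrn n u : ev (quad_sqrn h s A B C n u) = ev u ^+ (2 ^ n).
Proof.
elim: n => [|n IHn]; first by rewrite expn0 expr1.
by rewrite [LHS]quad_eval_mul IHn -expr2 -exprM expnSr.
Qed.

End QuadEval.

(** * Nilpotent elements modulo p *)

(** The norm form of F[t], with [t^2 = -s], has no nontrivial zero: F[t] is a
    field. *)
Definition anisotropic (F : fieldType) (s : F) :=
  forall x y : F, x ^+ 2 + s * y ^+ 2 = 0 -> x = 0 /\ y = 0.

Lemma anisotropic_nonsquare (F : fieldType) (s : F) :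
  ~ (exists y : F, y ^+ 2 = - s) -> anisotropic s.
Proof.
move=> nsq x y e; have [y0|y0] := eqVneq y 0.
  by move: e; rewrite y0 expr0n mulr0 addr0 => /eqP; rewrite expf_eq0 => /eqP.
case: nsq; exists (x / y); apply/eqP; rewrite -subr_eq0 opprK.
have -> : (x / y) ^+ 2 + s = (x ^+ 2 + s * y ^+ 2) / y ^+ 2 by field.
by rewrite e mul0r.
Qed.

Section NilpotentQuads.
Variables (F : fieldType) (s : F).
Hypothesis s_aniso : anisotropic s.

(** The norm of the image of [u] in the quotient by [z], with values in F. *)
Definition low_norm (u : quad F) : F :=
  let: (u0, u1, _, _) := u in u0 ^+ 2 + s * u1 ^+ 2.

Lemma low_normM (h : F) u v :
  low_norm (quad_mul h s 0 0 0 u v) = low_norm u * low_norm v.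
Proof. by case: u v => [[[u0 u1] u2] u3] [[[v0 v1] v2] v3] /=; ring. Qed.

Lemma low_norm_sqrn0 (h : F) n u :
  low_norm (quad_sqrn h s 0 0 0 n u) = 0 -> low_norm u = 0.
Proof.
elim: n => //= n IHn /eqP; rewrite low_normM mulf_eq0 orbb => /eqP.
exact: IHn.
Qed.

(** With [E = u0 + u1 t] and [G = u2 + u3 t], the square of [E + G z] is
    [(E^2 + G^2 z^2) + 2 E G z].  If it vanishes, one of the elements [E], [G] of
    the field F[t] is zero, and then so is the other, as [z^2 = -(B t + C)] is
    nonzero. *)
Lemma quad_sqr0 (B C : F) (u : quad F) : 2 != 0 :> F -> ~ (B = 0 /\ C = 0) ->
  quad_mul 0 s 0 B C u u = (0, 0, 0, 0) -> u = (0, 0, 0, 0).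
Proof.
case: u => [[[u0 u1] u2] u3] two_neq0 BC_neq0 [c0 c1 c2 c3].
have norm_prod : (u0 ^+ 2 + s * u1 ^+ 2) * (u2 ^+ 2 + s * u3 ^+ 2) = 0.
  have e2 : u0 * u2 - s * (u1 * u3) = 0.
    by apply: (mulfI two_neq0); rewrite mulr0 -[RHS]c2; ring.
  have e3 : u0 * u3 + u1 * u2 = 0.
    by apply: (mulfI two_neq0); rewrite mulr0 -[RHS]c3; ring.
  transitivity ((u0 * u2 - s * (u1 * u3)) ^+ 2 + s * (u0 * u3 + u1 * u2) ^+ 2).
    by ring.
  by rewrite e2 e3; ring.
(* E = 0 is the first case, and G = 0 the second one *)
move/eqP: norm_prod; rewrite mulf_eq0 => /orP[] /eqP/s_aniso[z1 z2]; subst.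
  have : (u2 ^+ 2 + s * u3 ^+ 2) ^+ 2 * (C ^+ 2 + s * B ^+ 2) = 0.
    (* k0 + k1 t is the value of G^2 (B t + C) *)
    pose k0 := (u2 ^+ 2 - s * u3 ^+ 2) * C - 2 * s * B * (u2 * u3).
    pose k1 := (u2 ^+ 2 - s * u3 ^+ 2) * B + 2 * C * (u2 * u3).
    transitivity (k0 ^+ 2 + s * k1 ^+ 2); first by rewrite /k0 /k1; ring.
    have -> : k0 = 0 by rewrite -oppr0 -[in RHS]c0 /k0; ring.
    have -> : k1 = 0 by rewrite -oppr0 -[in RHS]c1 /k1; ring.
    by ring.
  move/eqP; rewrite mulf_eq0 expf_eq0 /= => /orP[] /eqP/s_aniso[e1 e2].
    by rewrite e1 e2.
  by case: BC_neq0.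
have : (u0 ^+ 2 + s * u1 ^+ 2) ^+ 2 = 0.
  transitivity ((u0 ^+ 2 - s * u1 ^+ 2) ^+ 2 + s * (2 * (u0 * u1)) ^+ 2).
    by ring.
  have -> : u0 ^+ 2 - s * u1 ^+ 2 = 0 by rewrite -[RHS]c0; ring.
  have -> : 2 * (u0 * u1) = 0 by rewrite -[RHS]c1; ring.
  by ring.
by move/eqP; rewrite expf_eq0 /= => /eqP/s_aniso[-> ->].
Qed.

Lemma quad_sqrn0 (B C : F) n (u : quad F) : 2 != 0 :> F -> ~ (B = 0 /\ C = 0) ->
  quad_sqrn 0 s 0 B C n u = (0, 0, 0, 0) -> u = (0, 0, 0, 0).
Proof. by move=> F2 BC; elim: n => //= n IHn /quad_sqr0 -/(_ F2 BC). Qed.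

End NilpotentQuads.

(** * Integrality *)

(** Multiply an integral equation of [x / p], of degree [n], by [p ^ n]: all terms
    but [x ^ n] acquire a factor [p] with a cofactor in [S].  The exponent is then
    raised to a power of 2. *)
Lemma integral_div_nilp (K : fieldType) (S : K -> Prop) (p : nat) (x : K) :
    (forall m : int, S m%:~R) -> (forall u v, S u -> S v -> S (u + v)) ->
    (forall u v, S u -> S v -> S (u * v)) -> p%:R != 0 :> K ->
    S x -> integralOver (intr : int -> K) (x / p%:R) ->
  exists n w, S w /\ x ^+ (2 ^ n) = p%:R * w.
Proof.
move=> Sint Sadd Smul p_neq0 Sx [P Pmon /rootP Px0].
have Sexp u n : S u -> S (u ^+ n).
  move=> Su; elim: n => [|n IHn]; first exact: (Sint 1).
  by rewrite exprS; apply: (Smul _ _).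
have szP : size P = (size P).-1.+1.
  by rewrite prednK // size_poly_gt0 monic_neq0.
set n := (size P).-1 in szP.
pose T (i : nat) : K := (P`_i)%:~R * (p ^ (n - i).-1)%:R * x ^+ i.
have xn : x ^+ n = p%:R * - (\sum_(i < n) T i).
  have : p%:R ^+ n * (map_poly (intr : int -> K) P).[x / p%:R] = 0.
    by rewrite Px0 mulr0.
  rewrite horner_coef size_map_poly_id0 ?(monicP Pmon) ?rmorph1 ?oner_neq0 //.
  rewrite szP big_ord_recr /= coef_map /= -/(lead_coef P) (monicP Pmon) mul1r.
  rewrite mulrDr exprMn exprVn [X in _ + X]mulrCA divff ?expf_neq0 // mulr1.
  move/eqP.
  rewrite addrC addr_eq0 => /eqP ->; rewrite mulrN mulr_sumr mulr_sumr.
  congr (- _); apply: eq_bigr => i _; rewrite coef_map /T /= natrX.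
  have -> : p%:R ^+ n = p%:R ^+ (n - i).-1 * p%:R * p%:R ^+ i :> K.
    by rewrite -exprSr -exprD prednK ?subn_gt0 ?subnK // ltnW.
  rewrite exprMn exprVn.
  have pi0 : p%:R ^+ i != 0 :> K by rewrite expf_neq0.
  by field.
exists n, (x ^+ (2 ^ n - n) * - (\sum_(i < n) T i)); split; last first.
  by rewrite mulrCA -xn -exprD subnK // ltnW // ltn_expl.
apply: (Smul _ _); first exact: Sexp.
rewrite -mulN1r; apply: (Smul _ _).
  by have := Sint (-1); rewrite rmorphN1.
apply: (big_ind S) => // [|i _]; first exact: (Sint 0).
apply: (Smul _ _); last exact: Sexp.
by apply: (Smul _ _); last exact: (Sint _%:Z).
Qed.

Lemma integral_quadratic (K : fieldType) (y d e : K) :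
    integralOver (intr : int -> K) d -> integralOver (intr : int -> K) e ->
  y ^+ 2 = - (d * y + e) -> integralOver (intr : int -> K) y.
Proof.
move=> d_int e_int y2E; pose P := Poly [:: e; d; 1].
have szP : size P = 3%N by rewrite (PolyK (c := 0)) //= oner_neq0.
apply: (integral_root_monic (p := P)).
- by rewrite monicE lead_coefE szP coef_Poly.
- rewrite /root horner_Poly /=; apply/eqP.
  by transitivity (y ^+ 2 + (d * y + e)); [ring | rewrite y2E addNr].
apply/integral_poly => i; rewrite coef_Poly; case: i => [|[|[|i]]] //=.
- exact: integral1.
- by rewrite nth_nil; apply: integral0.
Qed.

(** * The factorization of the quartic modulo p *)

Lemma intr_Fp_eq0 (p : nat) (x : int) : prime p ->
  (x%:~R == 0 :> 'F_p) = (p%:Z %| x)%Z.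
Proof. by move=> p_pr; rewrite (dvdz_pcharf (pchar_Fp p_pr)). Qed.

Lemma map_quartic (R : nzRingType) (a b c : int) :
  map_poly (intr : int -> R) (quartic a b c) =
    'X^4 + a%:~R *: 'X^2 + b%:~R *: 'X + (c%:~R)%:P.
Proof.
by rewrite /quartic !rmorphD /= !map_polyZ !map_polyXn map_polyX map_polyC.
Qed.

Section QuarticModP.
Variables (p : nat).
Hypotheses (p_prime : prime p) (p_gt2 : (2 < p)%N).

Lemma two_neq0_Fp : 2 != 0 :> 'F_p.
Proof.
rewrite -[2]/(2%:~R) intr_Fp_eq0 //; apply/negP => /dvdn_leq.
by move=> /(_ isT); rewrite leqNgt p_gt2.
Qed.

(** If [f = g^2] with [g = al X^2 + be X + ga], the missing cubic term forces
    [be = 0], and [al^2 = 1]; so [a = 2 al ga] and [c = ga^2], and a square root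
    of [-a/2 = - al ga] would be a root of [g].  Conversely [g = X^2 + a/2]. *)
Lemma quartic_mod_square (a b c : int) :
  (exists g : {poly 'F_p},
      [/\ size g = 3%N, irreducible_poly g
        & map_poly (intr : int -> 'F_p) (quartic a b c) = g ^+ 2]) <->
  [/\ (p%:Z %| b)%Z, ~~ (p%:Z %| a * c)%Z, (a ^+ 2 = 4 * c %[mod p%:Z])%Z
       & ~ exists y : 'F_p, y ^+ 2 = - (a%:~R / 2)].
Proof.
have F2 := two_neq0_Fp.
have modE : (a ^+ 2 = 4 * c %[mod p%:Z])%Z = (a%:~R ^+ 2 = 4 * c%:~R :> 'F_p).
  rewrite propeqE; split=> [/eqP|e].
    rewrite eqz_mod_dvd -intr_Fp_eq0 // rmorphB rmorphXn rmorphM /= subr_eq0.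
    by move/eqP.
  apply/eqP; rewrite eqz_mod_dvd -intr_Fp_eq0 //.
  by rewrite rmorphB rmorphXn rmorphM /= e subrr.
rewrite modE -!intr_Fp_eq0 // rmorphM mulf_eq0 negb_or map_quartic /=.
set a' : 'F_p := a%:~R; set b' : 'F_p := b%:~R; set c' : 'F_p := c%:~R.
split=> [[g [szg g_irr e]] | [/eqP b0 ac0 ac nsq]].
  have gE : g = g`_2 *: 'X^2 + g`_1 *: 'X + (g`_0)%:P.
    apply/polyP => i; rewrite !coefE.
    case: i => [|[|[|i]]] /=; rewrite ?(mulr0, mulr1, addr0, add0r) //.
    by apply: nth_default; rewrite szg.
  have g_noroot x : ~ root g x.
    move=> gx; have /eqp_size : 'X - x%:P %= g.
      by apply: (apply_irredp g_irr); rewrite ?size_XsubC // dvdp_XsubCl.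
    by rewrite size_XsubC szg.
  have hornerg x : g.[x] = g`_2 * x ^+ 2 + g`_1 * x + g`_0.
    by rewrite [in LHS]gE !hornerE.
  set al := g`_2 in gE hornerg; set be := g`_1 in gE hornerg.
  set ga := g`_0 in gE hornerg.
  have g2E : g ^+ 2 = (al ^+ 2) *: 'X^4 + (2 * al * be) *: 'X^3
      + (be ^+ 2 + 2 * al * ga) *: 'X^2 + (2 * be * ga) *: 'X + (ga ^+ 2)%:P.
    by rewrite gE -!mul_polyC; ring.
  have coefs i := congr1 (fun P : {poly 'F_p} => P`_i) e.
  have e0 := coefs 0%N; have e1 := coefs 1%N; have e2 := coefs 2%N.
  have e3 := coefs 3%N; have e4 := coefs 4%N.
  move: e0 e1 e2 e3 e4; rewrite g2E !coefE /=.
  rewrite !(mulr0, mulr1, addr0, add0r) => cE bE aE be0 al1.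
  have al0 : al != 0.
    by apply/eqP => al0; move/eqP: al1; rewrite al0 expr0n oner_eq0.
  have {}be0 : be = 0.
    by move/esym/eqP: be0; rewrite !mulf_eq0 (negPf F2) (negPf al0) => /eqP.
  have ga0 : ga != 0.
    apply/eqP => ga0; apply: (g_noroot 0); apply/rootP.
    by rewrite hornerg be0 ga0; ring.
  rewrite be0 in aE bE; split.
  - by rewrite bE; apply/eqP; ring.
  - by rewrite aE cE expr0n add0r !mulf_neq0 ?expf_neq0.
  - rewrite aE cE; transitivity (4 * al ^+ 2 * ga ^+ 2); first by ring.
    by rewrite -al1; ring.
  - case=> y yE; apply: (g_noroot y); apply/rootP.
    rewrite hornerg be0 yE aE.
    transitivity (- al ^+ 2 * ga + ga); first by field.
    by rewrite -al1; ring.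
have a2E : a' = 2 * (a' / 2) by field.
set k := a' / 2 in a2E nsq.
have cE : c' = k ^+ 2.
  apply: (mulfI (mulf_neq0 F2 F2)); transitivity (4 * c'); first by ring.
  by rewrite -ac a2E; ring.
have szg : size ('X^2 + k%:P) = 3%N.
  by rewrite size_addl ?size_polyXn // (leq_ltn_trans (size_polyC_leq1 _)).
exists ('X^2 + k%:P); split=> //.
  apply: cubic_irreducible; first by rewrite szg.
  move=> x; apply/negP; rewrite /root !hornerE addr_eq0 => /eqP xE.
  by apply: nsq; exists x.
by rewrite b0 cE a2E -!mul_polyC; ring.
Qed.

End QuarticModP.

(** * Maximality at p *)

Section Maximality.
Variables (K : fieldType) (p : nat) (t z : K) (h s A B C : int).
Hypothesis p_prime : prime p.
Hypothesis p_neq2 : 2 != 0 :> 'F_p.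
Hypothesis t2E : t ^+ 2 = h%:~R * z - s%:~R.
Hypothesis z2E : z ^+ 2 = - (A%:~R * z + B%:~R * t + C%:~R).
Notation ev := (quad_eval (intr : int -> K) t z).
Hypothesis ev_inj : injective ev.
Hypotheses (t_int : integralOver (intr : int -> K) t)
           (z_int : integralOver (intr : int -> K) z).
Hypothesis s_aniso : anisotropic (s%:~R : 'F_p).
Hypothesis pA : (p%:Z %| A)%Z.

Notation integral := (integralOver (intr : int -> K)).
Notation red := (quad_map (intr : int -> 'F_p)).

Let p_neq0 : p%:R != 0 :> K.
Proof.
apply/eqP => p0; have : (p%:Z, 0, 0, 0) = (0, 0, 0, 0) :> quad int.
  by apply: ev_inj => /=; rewrite -[_%:~R]/(p%:R : K) p0.
by case => p0'; move: p_prime; rewrite p0'.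
Qed.

Lemma integral_eval u : integral (ev u).
Proof.
case: u => [[[u0 u1] u2] u3] /=.
by do !apply: integral_add; do ?apply: integral_mul => //; apply: integral_id.
Qed.

Lemma red_eq0 u : red u = (0, 0, 0, 0) -> exists v, u = quad_scale p%:Z v.
Proof.
case: u => [[[u0 u1] u2] u3] [] /eqP + /eqP + /eqP + /eqP.
rewrite !intr_Fp_eq0 // => /dvdzP[v0 ->] /dvdzP[v1 ->].
move=> /dvdzP[v2 ->] /dvdzP[v3 ->].
by exists (v0, v1, v2, v3); rewrite /quad_scale /= ![_%:Z * _]mulrC.
Qed.

Lemma red_nilpotent u : integral (ev u / p%:R) ->
  exists n,
    quad_sqrn (h%:~R : 'F_p) s%:~R 0 B%:~R C%:~R n (red u) = (0, 0, 0, 0).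
Proof.
move=> u_int.
have [||||n [_ [[w ->] un]]] :=
    integral_div_nilp (S := fun y => exists w, y = ev w) _ _ _ p_neq0 _ u_int.
- by move=> m; exists (m, 0, 0, 0) => /=; ring.
- move=> _ _ [v ->] [w ->]; case: v w => [[[v0 v1] v2] v3] [[[w0 w1] w2] w3].
  by exists (v0 + w0, v1 + w1, v2 + w2, v3 + w3) => /=; rewrite !rmorphD; ring.
- by move=> _ _ [v ->] [w ->]; exists (quad_mul h s A B C v w);
    rewrite (quad_eval_mul t2E z2E).
- by exists u.
exists n; have A0 : A%:~R = 0 :> 'F_p by apply/eqP; rewrite intr_Fp_eq0.
have : quad_sqrn h s A B C n u = quad_scale p%:Z w.
  by apply: ev_inj; rewrite (quad_eval_sqrn t2E z2E) quad_eval_scale un.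
move/(congr1 red); rewrite quad_map_sqrn /= A0 => ->.
case: w {un} => [[[w0 w1] w2] w3] /=; rewrite !rmorphM /=.
by rewrite -[p%:~R]/(p%:R : 'F_p) pchar_Fp_0 // !mul0r.
Qed.

Lemma integral_div_unramified u : (p%:Z %| h)%Z ->
    ~ ((p%:Z %| B)%Z /\ (p%:Z %| C)%Z) ->
  integral (ev u / p%:R) -> exists v, u = quad_scale p%:Z v.
Proof.
rewrite -!intr_Fp_eq0 // => /eqP h0 BC0 /red_nilpotent[n].
rewrite h0 => /quad_sqrn0 => un; apply/red_eq0/un => //.
by case=> B0 C0; apply: BC0; rewrite B0 C0 eqxx.
Qed.

(** When [p] divides [A], [B] and [C], the norm on [O/(p, z)] is multiplicative,
    so it kills the nilpotent elements. *)
Lemma integral_div_low u : (p%:Z %| B)%Z -> (p%:Z %| C)%Z ->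
  integral (ev u / p%:R) -> low_norm s%:~R (red u) = 0.
Proof.
rewrite -!intr_Fp_eq0 // => /eqP B0 /eqP C0 /red_nilpotent[n].
rewrite B0 C0 => un; apply: (@low_norm_sqrn0 _ _ h%:~R n).
by rewrite un /=; ring.
Qed.

(** Here [p] is [z^2] up to a unit at [p], and [z] generates the maximal ideal:
    an element [g z] of this ideal with [g z / p] integral is tested through the
    square of [g z / p], which brings one factor [p] back to the numerator. *)
Lemma integral_div_ramified u : (p%:Z %| B)%Z -> (p%:Z %| C)%Z ->
    ~ (((p ^ 2)%N%:Z %| B)%Z /\ ((p ^ 2)%N%:Z %| C)%Z) ->
  integral (ev u / p%:R) -> exists v, u = quad_scale p%:Z v.
Proof.
move=> pB pC p2BC u_int.
have low u' := @integral_div_low u' pB pC.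
case: u u_int => [[[u0 u1] u2] u3] u_int.
have [u00 u10] := s_aniso (low _ u_int).
have /eqP := u00; rewrite intr_Fp_eq0 // => /dvdzP[v0 u0E].
have /eqP := u10; rewrite intr_Fp_eq0 // => /dvdzP[v1 u1E].
have [A' AE] := dvdzP pA; have [B' BE] := dvdzP pB; have [C' CE] := dvdzP pC.
(* u is g z modulo p, and d is - z ^ 2 / p *)
pose g : quad int := (u2, u3, 0, 0); pose d : quad int := (C', B', A', 0).
have gz_int : integral (ev g * z / p%:R).
  have -> : ev g * z / p%:R = ev (u0, u1, u2, u3) / p%:R - ev (v0, v1, 0, 0).
    rewrite /= u0E u1E !rmorphM /= -[p%:~R]/(p%:R : K).
    by field.
  by apply: integral_sub => //; apply: integral_eval.
pose g2d := quad_mul h s A B C (quad_mul h s A B C g g) d.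
have g2d_int : integral (ev g2d / p%:R).
  have -> : ev g2d / p%:R = - ((ev g * z / p%:R) * (ev g * z / p%:R)).
    rewrite !(quad_eval_mul t2E z2E).
    have -> : ev d = - (z ^+ 2 / p%:R).
      rewrite z2E AE BE CE /= !rmorphM /= -[p%:~R]/(p%:R : K); field.
      exact: p_neq0.
    by field.
  by apply/integral_opp/integral_mul.
have red_mul (v w : quad int) : red (quad_mul h s A B C v w) =
    quad_mul h%:~R s%:~R A%:~R B%:~R C%:~R (red v) (red w).
  exact: quad_map_mul.
have := low _ g2d_int; rewrite /g2d !red_mul.
have /eqP -> : A%:~R == 0 :> 'F_p by rewrite intr_Fp_eq0.
have /eqP -> : B%:~R == 0 :> 'F_p by rewrite intr_Fp_eq0.
have /eqP -> : C%:~R == 0 :> 'F_p by rewrite intr_Fp_eq0.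
rewrite !low_normM => /eqP; rewrite !mulf_eq0 orbb => /orP[] /eqP/s_aniso[].
  by move=> u20 u30; apply: red_eq0 => /=; rewrite u00 u10 u20 u30.
move=> /eqP + /eqP; rewrite !intr_Fp_eq0 // => pC' pB'; case: p2BC.
by rewrite BE CE -mulnn PoszM !dvdz_mul.
Qed.

Hypothesis max_hyp :
  ((p%:Z %| h)%Z /\ ~ ((p%:Z %| B)%Z /\ (p%:Z %| C)%Z)) \/
  [/\ (p%:Z %| B)%Z, (p%:Z %| C)%Z &
      ~ (((p ^ 2)%N%:Z %| B)%Z /\ ((p ^ 2)%N%:Z %| C)%Z)].

Lemma integral_div_pexp k u :
  integral (ev u / p%:R ^+ k) -> exists v, u = quad_scale (p%:Z ^+ k) v.
Proof.
elim: k u => [|k IHk] u u_int.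
  exists u; case: u {u_int} => [[[u0 u1] u2] u3] /=.
  by rewrite expr0 /quad_scale /= !mul1r.
have : integral (ev u / p%:R).
  have -> : ev u / p%:R = ev u / p%:R ^+ k.+1 * p%:R ^+ k.
    by rewrite exprS; field; rewrite p_neq0 expf_neq0.
  by apply: integral_mul => //; rewrite -natrX; apply: integral_nat.
have max u' : integral (ev u' / p%:R) -> exists v, u' = quad_scale p%:Z v.
  case: max_hyp => [[ph BC]|[pB pC p2BC]].
    exact: integral_div_unramified.
  exact: integral_div_ramified.
case/max=> v uE; have [|w vE] := IHk v.
  have <- : ev u / p%:R ^+ k.+1 = ev v / p%:R ^+ k; last by [].
  have -> : ev u = p%:R * ev v by rewrite uE quad_eval_scale.
  by rewrite exprS; field; rewrite p_neq0 expf_neq0.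
exists w; rewrite uE vE; case: w {vE} => [[[w0 w1] w2] w3].
by rewrite /quad_scale /= !mulrA -!exprS.
Qed.

End Maximality.

(** * The field generated by theta *)

Section SimpleExtension.
Variables (Omega : fieldType) (iota : {rmorphism rat -> Omega}).
Variables (f : {poly rat}) (theta : Omega).
Hypothesis f_irr : irreducible_poly f.
Hypothesis f_theta : root (map_poly iota f) theta.
Notation hornerQ P := (map_poly iota P).[theta].

(** Otherwise a Bezout relation between [f] and [P], evaluated at [theta], would
    give a nonzero constant equal to zero. *)
Lemma hornerQ_eq0 (P : {poly rat}) : hornerQ P = 0 -> f %| P.
Proof.
move=> P0; apply/negPn; rewrite -(irreducible_poly_coprime _ f_irr).
apply/negP => /Bezout_coprimepP[[u v]] /= /eqpf_eq[c c0 e].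
have /eqP := congr1 (fun Q => hornerQ Q) e.
rewrite rmorphD !rmorphM /= !hornerE P0 (rootP f_theta) !mulr0 addr0.
by rewrite -mul_polyC mulr1 map_polyC hornerC eq_sym fmorph_eq0 (negPf c0).
Qed.

Lemma hornerQ_small (P : {poly rat}) :
  (size P < size f)%N -> hornerQ P = 0 -> P = 0.
Proof.
move=> szP /hornerQ_eq0 fP; apply/eqP; apply: contraLR szP => P0.
by rewrite -leqNgt dvdp_leq.
Qed.

Lemma hornerQ_mod (P : {poly rat}) : hornerQ (P %% f) = hornerQ P.
Proof.
by rewrite [in RHS](divp_eq P f) rmorphD rmorphM /= !hornerE (rootP f_theta)
  mulr0 add0r.
Qed.

Lemma hornerQ_inv (P : {poly rat}) : exists Q, (hornerQ P)^-1 = hornerQ Q.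
Proof.
have [P0|P0] := eqVneq (hornerQ P) 0.
  by exists 0; rewrite P0 invr0 rmorph0 horner0.
have : coprimep f P.
  rewrite irreducible_poly_coprime //; apply: contra P0 => /dvdpP[Q ->].
  by rewrite rmorphM /= hornerM (rootP f_theta) mulr0.
case/Bezout_coprimepP=> [[u v]] /= /eqpf_eq[c c0 e].
exists (c^-1 *: v); apply: (mulfI P0); rewrite divff //.
have := congr1 (fun Q => hornerQ Q) e.
rewrite rmorphD !rmorphM /= !hornerE (rootP f_theta) !mulr0 add0r.
rewrite -mul_polyC mulr1 map_polyC hornerC map_polyZ hornerZ.
rewrite mulrCA [_ * hornerQ v]mulrC => ->.
by rewrite -rmorphM mulVf // rmorph1.
Qed.
End SimpleExtension.

Section Qadjoin.
Variables (Omega : fieldType) (iota : {rmorphism rat -> Omega}).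

(** The values at [theta] of rational polynomials already form a field. *)
Lemma Qadjoin_horner (f : {poly rat}) (theta x : Omega) :
    irreducible_poly f -> root (map_poly iota f) theta ->
  Qadjoin theta x -> exists P : {poly rat}, x = (map_poly iota P).[theta].
Proof.
move=> f_irr f_theta.
pose X := [set y | exists P, y = (map_poly iota P).[theta]]%classic.
apply: (smallest_sub (X := X)).
  split; first by rewrite inE; exists 1; rewrite rmorph1 hornerC.
    move=> _ _ /set_mem[P ->] /set_mem[Q ->]; apply/mem_set; exists (P - Q).
    by rewrite rmorphB hornerD hornerN.
  move=> _ _ /set_mem[P ->] /set_mem[Q ->]; apply/mem_set.
  have [Q' ->] := hornerQ_inv f_irr f_theta Q.
  by exists (P * Q'); rewrite rmorphM hornerM.
by move=> _ ->; exists 'X; rewrite map_polyX hornerX.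
Qed.

Lemma Qadjoin_divring_closed (theta : Omega) :
  GRing.divring_closed (mem (Qadjoin theta)).
Proof.
split.
- by apply/mem_set => S [[S1 _ _] _]; apply/set_mem.
- move=> x y /set_mem Kx /set_mem Ky; apply/mem_set => S KS.
  have [[_ Ssub _] _] := KS; apply/set_mem/Ssub; apply/mem_set; first exact: Kx.
  exact: Ky.
- move=> x y /set_mem Kx /set_mem Ky; apply/mem_set => S KS.
  have [[_ _ Sdiv] _] := KS; apply/set_mem/Sdiv; apply/mem_set; first exact: Kx.
  exact: Ky.
Qed.

Lemma Qadjoin_id (theta : Omega) : Qadjoin theta theta.
Proof. by move=> S [_]; apply. Qed.

Lemma Qadjoin_div (theta x y : Omega) :
  Qadjoin theta x -> Qadjoin theta y -> Qadjoin theta (x / y).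
Proof.
have [_ _ Kdiv] := Qadjoin_divring_closed theta.
by move=> Kx Ky; apply/set_mem/Kdiv; apply/mem_set.
Qed.

Lemma Qadjoin_mul (theta x y : Omega) :
  Qadjoin theta x -> Qadjoin theta y -> Qadjoin theta (x * y).
Proof.
have [K1 _ _] := Qadjoin_divring_closed theta.
move=> Kx Ky; rewrite -[y]invrK -[y^-1]mul1r.
by do 2!apply: Qadjoin_div => //; apply/set_mem.
Qed.

Lemma Qadjoin_add (theta x y : Omega) :
  Qadjoin theta x -> Qadjoin theta y -> Qadjoin theta (x + y).
Proof.
have [K1 Ksub _] := Qadjoin_divring_closed theta.
have K0 : 0 \in Qadjoin theta by rewrite -(subrr 1); apply: (Ksub).
move=> /mem_set Kx /mem_set Ky; apply/set_mem; rewrite -[y]opprK.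
by apply: (Ksub) => //; rewrite -sub0r; apply: (Ksub).
Qed.

Lemma Qadjoin_int (theta : Omega) (m : int) : Qadjoin theta m%:~R.
Proof.
have [K1 Ksub _] := Qadjoin_divring_closed theta.
have K0 : 0 \in Qadjoin theta by rewrite -(subrr 1); apply: (Ksub).
have Knat n : Qadjoin theta n%:R.
  elim: n => [|n IHn]; first exact/set_mem.
  by rewrite -natr1; apply: Qadjoin_add => //; apply/set_mem.
case: m => n; first exact: Knat.
rewrite NegzE rmorphN -sub0r; apply/set_mem/(Ksub) => //.
exact: (mem_set (Knat n.+1)).
Qed.

Lemma Qadjoin_rat (theta : Omega) (r : rat) :
  Qadjoin theta (iota r).
Proof.
rewrite -[r]divq_num_den fmorph_div /= !rmorph_int.
by apply: Qadjoin_div; exact: Qadjoin_int.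
Qed.

End Qadjoin.

(** * Coordinates of the elements of the quartic field *)

Lemma quad_common_denominator (r : quad rat) :
  exists d (u : quad int), (0 < d)%N /\ quad_map intr u = quad_scale d%:R r.
Proof.
have den_gt0 (x : rat) : (0 < `|denq x|)%N by rewrite absz_gt0 denq_neq0.
have denE (x : rat) : (numq x)%:~R = (`|denq x|%N)%:R * x.
  by rewrite numqE natr_absz normr_denq mulrC.
case: r => [[[r0 r1] r2] r3].
pose d0 := `|denq r0|%N; pose d1 := `|denq r1|%N.
pose d2 := `|denq r2|%N; pose d3 := `|denq r3|%N.
exists (d0 * d1 * d2 * d3)%N,
  (numq r0 * (d1 * d2 * d3)%N, numq r1 * (d0 * d2 * d3)%N,
   numq r2 * (d0 * d1 * d3)%N, numq r3 * (d0 * d1 * d2)%N).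
split; first by rewrite !muln_gt0 !den_gt0.
rewrite /quad_scale /= !intrM !denE -/d0 -/d1 -/d2 -/d3.
rewrite -![_%:Z%:~R]/(_%:R) !natrM.
by congr (_, _, _, _); ring.
Qed.

Section QuarticCoordinates.
Variables (Omega : fieldType) (iota : {rmorphism rat -> Omega}).
Variables (a b c : int) (theta : Omega).
Let f := map_poly (intr : int -> rat) (quartic a b c).
Hypothesis f_irr : irreducible_poly f.
Hypothesis theta_root :
  root (map_poly (intr : int -> Omega) (quartic a b c)) theta.

Lemma size_quartic : size f = 5%N.
Proof.
rewrite /f map_quartic -!addrA size_addl ?size_polyXn //.
rewrite !(leq_ltn_trans (size_add _ _)) // !gtn_max.
rewrite !(leq_ltn_trans (size_scale_leq _ _)) ?size_polyXn ?size_polyX //=.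
by rewrite (leq_ltn_trans (size_add _ _)) // gtn_max
  (leq_ltn_trans (size_scale_leq _ _)) ?size_polyX //
  (leq_ltn_trans (size_polyC_leq1 _)).
Qed.

Lemma root_map_iota : root (map_poly iota f) theta.
Proof.
rewrite /f -map_poly_comp (eq_map_poly (g := intr)) // => m /=.
by rewrite rmorph_int.
Qed.

Lemma quartic_theta :
  theta ^+ 4 + a%:~R * theta ^+ 2 + b%:~R * theta + c%:~R = 0.
Proof. by have /rootP := theta_root; rewrite map_quartic !hornerE. Qed.

Variables (h s : int).
Hypothesis h_neq0 : h != 0.
Let z := (theta ^+ 2 + s%:~R) / h%:~R.

Let hQ_neq0 : h%:~R != 0 :> rat. Proof. by rewrite intr_eq0. Qed.
Let hK_neq0 : h%:~R != 0 :> Omega.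
Proof. by rewrite -(rmorph_int iota) fmorph_eq0. Qed.

(** The left-hand side is the value at [theta] of a polynomial of degree at most
    3, whose coefficients determine [r]. *)
Lemma quad_evalQ_eq0 r : quad_eval iota theta z r = 0 -> r = (0, 0, 0, 0).
Proof.
case: r => [[[r0 r1] r2] r3] r_eq0.
pose P : {poly rat} :=
  Poly [:: r0 + r2 * s%:~R / h%:~R; r1 + r3 * s%:~R / h%:~R;
           r2 / h%:~R; r3 / h%:~R].
have /(hornerQ_small f_irr root_map_iota) P0 : (size P < size f)%N.
  by rewrite size_quartic (leq_ltn_trans (size_Poly _)).
have {}P0 : P = 0.
  apply: P0; rewrite map_Poly_id0 ?rmorph0 // horner_Poly /= -[RHS]r_eq0 /= /z.
  by rewrite !(rmorphD, rmorphM, fmorphV, rmorph_int) /=; field.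
have coefP i : P`_i = 0 by rewrite P0 coef0.
move: (coefP 0%N) (coefP 1%N) (coefP 2%N) (coefP 3%N).
rewrite /P !coef_Poly /= => c0 c1.
move/eqP; rewrite mulf_eq0 invr_eq0 (negPf hQ_neq0) orbF => /eqP r20.
move/eqP; rewrite mulf_eq0 invr_eq0 (negPf hQ_neq0) orbF => /eqP r30.
by move: c0 c1; rewrite r20 r30 !mul0r !addr0 => -> ->.
Qed.

Lemma quad_eval_int u :
  quad_eval (intr : int -> Omega) theta z u =
    quad_eval iota theta z (quad_map intr u).
Proof. by case: u => [[[u0 u1] u2] u3] /=; rewrite !rmorph_int. Qed.

Lemma quad_evalZ_inj : injective (quad_eval (intr : int -> Omega) theta z).
Proof.
move=> [[[u0 u1] u2] u3] [[[v0 v1] v2] v3] /= uv.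
have : quad_eval iota theta z
    (quad_map intr (u0 - v0, u1 - v1, u2 - v2, u3 - v3)) = 0.
  rewrite -quad_eval_int /= !rmorphB /=.
  by move/eqP: uv; rewrite -subr_eq0 => /eqP <-; ring.
case/quad_evalQ_eq0 => /eqP + /eqP + /eqP + /eqP.
by rewrite !intr_eq0 !subr_eq0 => /eqP-> /eqP-> /eqP-> /eqP->.
Qed.

Lemma Qadjoin_quad x :
  Qadjoin theta x -> exists r, x = quad_eval iota theta z r.
Proof.
move/(Qadjoin_horner f_irr root_map_iota) => [P ->].
rewrite -(hornerQ_mod root_map_iota).
have szR : (size (P %% f)%R <= 4)%N.
  by rewrite -ltnS -size_quartic ltn_modp (irredp_neq0 f_irr).
rewrite (horner_coef_wide _ (n := 4)); last by rewrite size_map_poly.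
rewrite !big_ord_recl big_ord0 !coef_map /=; set c_ := nth 0 (P %% f).
(* theta ^ 2 = h z - s and theta ^ 3 = h theta z - s theta *)
exists (c_ 0%N - c_ 2%N * s%:~R, c_ 1%N - c_ 3%N * s%:~R,
        h%:~R * c_ 2%N, h%:~R * c_ 3%N).
rewrite /= /z !(rmorphD, rmorphN, rmorphM, rmorph_int) /=; field.
exact: hK_neq0.
Qed.

Lemma theta_sqrE : theta ^+ 2 = h%:~R * z - s%:~R.
Proof. by rewrite /z; field. Qed.

(** Multiplied by [h^2], this is [f(theta) = 0] expanded in powers of
    [theta^2 + s]. *)
Lemma z_sqrE (A B C : int) : a - 2 * s = h * A -> b = h ^+ 2 * B ->
    s ^+ 2 - a * s + c = h ^+ 2 * C ->
  z ^+ 2 = - (A%:~R * z + B%:~R * theta + C%:~R).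
Proof.
move=> aE bE cE.
have {}aE : a%:~R = h%:~R * A%:~R + 2 * s%:~R :> Omega.
  by rewrite -(rmorphM intr) -aE /= !rmorphD /= rmorphN !rmorphM /=; ring.
have {}bE : b%:~R = h%:~R ^+ 2 * B%:~R :> Omega by rewrite bE !rmorphM.
have {}cE : c%:~R = h%:~R ^+ 2 * C%:~R - s%:~R ^+ 2 + a%:~R * s%:~R :> Omega.
  rewrite -(rmorphXn intr) -(rmorphM intr) -cE /=.
  by rewrite !rmorphD /= !rmorphN !rmorphXn !rmorphM /=; ring.
apply: (mulfI (expf_neq0 2 hK_neq0)); apply/eqP; rewrite -subr_eq0; apply/eqP.
rewrite -[RHS]quartic_theta bE cE aE /z; field.
exact: hK_neq0.
Qed.

Lemma theta_integral : integralOver (intr : int -> Omega) theta.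
Proof.
exists (quartic a b c) => //; rewrite monicE.
have sz : size (quartic a b c) = 5%N.
  by rewrite -size_quartic /f size_map_inj_poly //; exact: intr_inj.
by rewrite lead_coefE sz /quartic !coefE /= !(mulr0, addr0).
Qed.

End QuarticCoordinates.

(** * Localization at p *)

Section Localization.
Variables (Omega : fieldType) (iota : {rmorphism rat -> Omega}).
Variables (p : nat) (p_prime : prime p).

Lemma Zloc_frac (x : int) (d : nat) : ~~ (p %| d)%N -> x%:~R / d%:R \in Zloc p.
Proof.
move=> pd; rewrite inE; apply: contra pd => p_den.
set r := x%:~R / d%:R in p_den.
have [->|d0] := posnP d; first exact: dvdn0.
have e : numq r * d%:Z = x * denq r.
  apply/eqP; rewrite -(eqr_int rat) !rmorphM /= numqE /r -[d%:~R]/(d%:R : rat).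
  by apply/eqP; field; rewrite pnatr_eq0 -lt0n.
apply: dvdn_trans p_den _.
have : (denq r %| numq r * d%:Z)%Z by rewrite e dvdz_mull.
by rewrite Gauss_dvdzr // coprimez_sym; exact: coprime_num_den.
Qed.

Lemma iota_denq (r : rat) : iota r * (`|denq r|%N)%:R = (numq r)%:~R.
Proof.
rewrite -(rmorph_nat iota) -rmorphM /= -(rmorph_int iota); congr (iota _).
by rewrite numqE natr_absz normr_denq.
Qed.

(** [N] is the product of the denominators of the [r i]. *)
Lemma integral_localized (n : nat) (r : 'I_n -> rat) (x : 'I_n -> Omega) :
    (forall i, r i \in Zloc p) ->
    (forall i, integralOver (intr : int -> Omega) (x i)) ->
  exists2 N, ~~ (p %| N)%N &
    integralOver (intr : int -> Omega) (N%:R * \sum_i iota (r i) * x i).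
Proof.
elim: n r x => [|n IHn] r x rP xP.
  exists 1%N; first by rewrite dvdn1; case: eqP p_prime => // ->.
  by rewrite big_ord0 mulr0; apply: integral0.
have [N pN Nint] :=
  IHn _ _ (fun i => rP (lift ord0 i)) (fun i => xP (lift ord0 i)).
exists (`|denq (r ord0)| * N)%N.
  by rewrite Euclid_dvdM // negb_or pN andbT; have := rP ord0; rewrite inE.
rewrite big_ord_recl natrM mulrDr; apply: integral_add.
  have -> : (`|denq (r ord0)|)%:R * N%:R * (iota (r ord0) * x ord0) =
    N%:R * (iota (r ord0) * (`|denq (r ord0)|)%:R) * x ord0 by ring.
  rewrite iota_denq; apply: integral_mul => //.
  by apply: integral_mul; [apply: integral_nat | apply: integral_id].
rewrite -mulrA; apply: integral_mul => //; exact: integral_nat.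
Qed.

End Localization.

Lemma localized_integersW (Omega : fieldType) (iota : {rmorphism rat -> Omega})
    p theta x : prime p ->
  Qadjoin theta x -> integralOver (intr : int -> Omega) x ->
  localized_integers iota p (Qadjoin theta) x.
Proof.
move=> p_pr Kx x_int; exists 1%N, (fun=> 1), (fun=> x); split=> //.
- by move=> _; rewrite inE dvdn1; case: eqP p_pr => // ->.
- by rewrite big_ord1 rmorph1 mul1r.
Qed.

Lemma Qadjoin_localized (Omega : fieldType) (iota : {rmorphism rat -> Omega}) p
    theta x :
  localized_integers iota p (Qadjoin theta) x -> Qadjoin theta x.
Proof.
move=> [n [r [y [_ y_int ->]]]].
have K0 : Qadjoin theta 0%:~R by exact: Qadjoin_int.
apply: (big_ind (fun u => Qadjoin theta u)) => [//|u v|i _].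
  exact: Qadjoin_add.
apply: Qadjoin_mul; first exact: Qadjoin_rat.
by have [] := y_int i.
Qed.

(** A multiple [N x] with [N] prime to [p] is integral, and [d x] has integer
    coordinates for some [d = d' p^k] with [d'] prime to [p].  Then [d' N x] is
    integral, and it is the quotient by [p^k] of the element [d N x], which has
    integer coordinates, so maximality makes the coordinates of [d' N x] integers. *)
Lemma localized_quad (Omega : fieldType) (iota : {rmorphism rat -> Omega})
    (p : nat) (t z x : Omega) : prime p ->
    (forall k (u : quad int),
       integralOver (intr : int -> Omega)
         (quad_eval (intr : int -> Omega) t z u / p%:R ^+ k) ->
       exists v, u = quad_scale (p%:Z ^+ k) v) ->
    (forall y, Qadjoin t y -> exists r, y = quad_eval iota t z r) ->
  localized_integers iota p (Qadjoin t) x ->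
  exists r0 r1 r2 r3,
    [/\ r0 \in Zloc p, r1 \in Zloc p, r2 \in Zloc p, r3 \in Zloc p &
     x = quad_eval iota t z (r0, r1, r2, r3)].
Proof.
move=> p_prime maxO span Kx; have {span}[e xE] := span _ (Qadjoin_localized Kx).
have [n [r [y [r_loc y_int xS]]]] := Kx.
have [N pN Nx_int] :=
  integral_localized iota p_prime r_loc (fun i => proj2 (y_int i)).
rewrite -xS in Nx_int.
have natK_neq0 k : (0 < k)%N -> k%:R != 0 :> Omega.
  by move=> k0; rewrite -(rmorph_nat iota) fmorph_eq0 pnatr_eq0 -lt0n.
have N_gt0 : (0 < N)%N by case: N pN {Nx_int}; rewrite ?dvdn0.
have [d [u [d_gt0 uE]]] := quad_common_denominator e.
have dx : quad_eval (intr : int -> Omega) t z u = d%:R * x.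
  rewrite xE -(rmorph_nat iota) -quad_eval_scale -uE.
  by case: u {uE} => [[[u0 u1] u2] u3] /=; rewrite !rmorph_int.
have [d' pd' dE] := pfactor_coprime p_prime d_gt0; set k := logn p d in dE.
have [|[[[v0 v1] v2] v3] vE] := maxO k (quad_scale N%:Z u).
  rewrite quad_eval_scale dx dE natrM natrX.
  have -> : N%:~R * (d'%:R * p%:R ^+ k * x) / p%:R ^+ k = d'%:R * (N%:R * x)
      :> Omega.
    rewrite -[N%:~R]/(N%:R : Omega); field.
    by rewrite expf_neq0 ?natK_neq0 ?prime_gt0.
  by apply: integral_mul => //; apply: integral_nat.
have pNd' : ~~ (p %| N * d')%N.
  by rewrite Euclid_dvdM // negb_or pN -prime_coprime.
have d'_gt0 : (0 < d')%N by move: d_gt0; rewrite dE muln_gt0 => /andP[].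
exists (v0%:~R / (N * d')%:R), (v1%:~R / (N * d')%:R), (v2%:~R / (N * d')%:R),
  (v3%:~R / (N * d')%:R).
split; try exact: Zloc_frac.
have := congr1 (quad_eval (intr : int -> Omega) t z) vE.
rewrite !quad_eval_scale dx dE natrM natrX rmorphXn /= -[N%:~R]/(N%:R : Omega).
rewrite -[p%:~R]/(p%:R : Omega) => eq_ev.
have {}eq_ev : N%:R * d'%:R * x =
    v0%:~R + v1%:~R * t + v2%:~R * z + v3%:~R * (t * z).
  apply: (mulfI (expf_neq0 k (natK_neq0 p (prime_gt0 p_prime)))).
  by rewrite -eq_ev; ring.
rewrite /= !fmorph_div !rmorph_int !rmorph_nat natrM.
transitivity (N%:R * d'%:R * x / (N%:R * d'%:R)).
  by field; rewrite !natK_neq0.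
by rewrite eq_ev; field; rewrite !natK_neq0.
Qed.

(** * Valuations of the structure constants *)

Lemma dvdz_pexp_logn (p : nat) (x : int) k : prime p -> x != 0 ->
  ((p ^ k)%N%:Z %| x)%Z = (k <= logn p `|x|)%N.
Proof. by move=> p_pr x0; rewrite dvdzE /= pfactor_dvdn // absz_gt0. Qed.

(** Let [D4 = 4c - a^2], of valuation [w], and [v = min(v_p(b), w)], so that
    [2 nu = v] and [m = v./2].  As [p^(m+1)] divides [a - 2s], the integer
    [E = s^2 - as + c], with [4E = (a - 2s)^2 + D4], is divisible by the same
    powers of [p] as [D4] up to the exponent [2m + 2].  Hence [p^k] divides both
    [b] and [E] exactly when [k <= v], for these [k]; the two cases are [v] odd
    and [v] even. *)
Lemma order_parameters (p : nat) (a b c s : int) :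
  prime p -> (2 < p)%N -> (p%:Z %| b)%Z -> (p%:Z %| 4 * c - a ^+ 2)%Z ->
  ((2^-1 : rat)%:E * vp p (4 * c - a ^+ 2) < vp p (a - 2 * s))%E ->
  exists m A B C,
    [/\ Num.floor (fine ((2^-1 : rat)%:E *
          Order.min (vp p b) (vp p (4 * c - a ^+ 2)))%E) = m%:Z,
        a - 2 * s = (p ^ m)%N%:Z * A, b = (p ^ (2 * m))%N%:Z * B,
        s ^+ 2 - a * s + c = (p ^ (2 * m))%N%:Z * C &
    (p%:Z %| A)%Z /\
    (((p%:Z %| (p ^ m)%N%:Z)%Z /\ ~ ((p%:Z %| B)%Z /\ (p%:Z %| C)%Z)) \/
     [/\ (p%:Z %| B)%Z, (p%:Z %| C)%Z &
      ~ (((p ^ 2)%N%:Z %| B)%Z /\ ((p ^ 2)%N%:Z %| C)%Z)])].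
Proof.
move=> p_pr p_gt2 pb pD s_close.
set D4 := 4 * c - a ^+ 2 in pD s_close *.
(* the hypothesis on s reads +oo < _ when D4 = 0 *)
have D4_neq0 : D4 != 0.
  apply/eqP => D40; move: s_close; rewrite D40 /vp eqxx.
  by rewrite gt0_muley ?lte_fin //; case: ifP.
set w := logn p `|D4|.
have dvdD4 k : ((p ^ k)%N%:Z %| D4)%Z = (k <= w)%N by rewrite dvdz_pexp_logn.
have close k : (2 * k <= w)%N -> ((p ^ k.+1)%N%:Z %| a - 2 * s)%Z.
  have [-> //|as0] := eqVneq (a - 2 * s) 0.
  move=> kw; rewrite dvdz_pexp_logn //.
  move: s_close; rewrite /vp (negPf D4_neq0) (negPf as0) -/w -EFinM lte_fin.
  move=> lt; rewrite -(ltr_nat rat); apply: le_lt_trans lt.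
  rewrite ler_pdivlMl // -natrM ler_nat; lia.
pose v := if b == 0 then w else minn (logn p `|b|) w.
have minE : Order.min (vp p b) (vp p D4) = (v%:R)%:E.
  rewrite /vp (negPf D4_neq0) -/w /v; case: ifP => _.
    by rewrite minEle leye_eq.
  by rewrite -EFin_min; congr EFin; rewrite /minn minElt ltr_nat; case: ifP.
have dvdv k : ((p ^ k)%N%:Z %| b)%Z && ((p ^ k)%N%:Z %| D4)%Z = (k <= v)%N.
  rewrite dvdD4 /v; have [->|b0] := eqVneq b 0; first by rewrite dvdz0.
  by rewrite dvdz_pexp_logn // leq_min.
have v_gt0 : (0 < v)%N by rewrite -dvdv expn1 pb.
have v_le_w : (v <= w)%N by have := leqnn v; rewrite -{1}dvdv dvdD4 => /andP[].
pose m := v./2.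
have m2v : (2 * m <= v)%N by rewrite /m; lia.
have v_lt : (v < 2 * m + 2)%N by rewrite /m; lia.
set E := s ^+ 2 - a * s + c.
have dvdE k : (k <= 2 * m + 2)%N ->
    ((p ^ k)%N%:Z %| E)%Z = ((p ^ k)%N%:Z %| D4)%Z.
  move=> km; have cop : coprimez (p ^ k)%N%:Z 4.
    rewrite coprimezE /= coprimeXl // prime_coprime //.
    by rewrite -[(1 + _)%N]/(2 ^ 2)%N Euclid_dvdX // gtnNdvd.
  rewrite -(Gauss_dvdzr _ cop).
  have -> : 4 * E = (a - 2 * s) * (a - 2 * s) + D4 by rewrite /E /D4; ring.
  apply: rpredDl; apply: (@dvdz_trans (p ^ (m.+1 + m.+1))%N%:Z).
    by rewrite dvdzE /= dvdn_exp2l //; lia.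
  rewrite expnD PoszM dvdz_mul // close //; exact: leq_trans v_le_w.
have pm_neq0 k : (p ^ k)%N%:Z != 0 by rewrite eqz_nat -lt0n expn_gt0 prime_gt0.
have dvd2m k : (k <= 2)%N -> ((p ^ (2 * m + k))%N%:Z %| b)%Z &&
    ((p ^ (2 * m + k))%N%:Z %| E)%Z = (2 * m + k <= v)%N.
  by move=> k2; rewrite dvdE ?dvdv // leq_add2l.
have [/dvdzP[B bE] /dvdzP[C EE]] :
    ((p ^ (2 * m))%N%:Z %| b)%Z /\ ((p ^ (2 * m))%N%:Z %| E)%Z.
  by apply/andP; have := dvd2m 0%N isT; rewrite addn0 m2v.
have /dvdzP[A' aE] := close m (leq_trans m2v v_le_w).
have dvdBC k : (k <= 2)%N ->
    ((p ^ k)%N%:Z %| B)%Z && ((p ^ k)%N%:Z %| C)%Z = (2 * m + k <= v)%N.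
  move=> k2; rewrite -dvd2m // bE EE expnD PoszM.
  by rewrite ![_ * (p ^ (2 * m))%N%:Z]mulrC !dvdz_mul2l.
exists m, (A' * p%:Z), B, C; split.
- rewrite minE -EFinM /=; apply: floor_def; apply/andP; split.
    by rewrite ler_pdivlMl // -[m%:~R]/(m%:R) -natrM ler_nat.
  rewrite ltr_pdivrMl // -[(m%:Z + 1)]/((m + 1)%N%:Z) -[(_)%:~R]/((m + 1)%:R).
  by rewrite -natrM ltr_nat; lia.
- by rewrite aE expnS PoszM; ring.
- by rewrite mulrC.
- by rewrite mulrC.
split; first exact: dvdz_mull.
have pE : p%:Z = (p ^ 1)%N%:Z by rewrite expn1.
have [v_odd|v_even] := leqP (2 * m + 1) v; [right | left].
  have /andP[pB pC] : ((p ^ 1)%N%:Z %| B)%Z && ((p ^ 1)%N%:Z %| C)%Z.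
    by rewrite dvdBC.
  rewrite expn1 in pB pC; split=> //; move/andP; rewrite dvdBC //.
  by rewrite leqNgt v_lt.
split; last by move/andP; rewrite pE dvdBC // leqNgt v_even.
by rewrite dvdzE /= -{1}(expn1 p) dvdn_exp2l //; lia.
Qed.

(** * The p-integral basis *)

Theorem mainTheorem3 (Omega : closedFieldType) (iota : {rmorphism rat -> Omega})
    (Omega_alg : algebraic_over_rat iota)
    (p : nat) (p_prime : prime p) (p_gt2 : (2 < p)%N)
    (a b c : int)
    (f_irr : irreducible_poly (map_poly (intr : int -> rat) (quartic a b c)))
    (theta : Omega)
    (theta_root : root (map_poly (intr : int -> Omega) (quartic a b c)) theta) :
  let f_mod_p_square :=
    exists g : {poly 'F_p},
      [/\ size g = 3%N, irreducible_poly g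
        & map_poly (intr : int -> 'F_p) (quartic a b c) = g ^+ 2] in
  (f_mod_p_square <->
     [/\ (p%:Z %| b)%Z, ~~ (p%:Z %| a * c)%Z, (a ^+ 2 = 4 * c %[mod p%:Z])%Z
       & ~ exists y : 'F_p, y ^+ 2 = - (a%:~R / 2)])
  /\
  (f_mod_p_square ->
   forall s : int,
     ((2^-1)%:E * vp p (4 * c - a ^+ 2) < vp p (a - 2 * s))%E ->
     let nu : \bar rat :=
       ((2^-1)%:E * Order.min (vp p b) (vp p (4 * c - a ^+ 2)))%E in
     let q : Omega := p%:R ^ Num.floor (fine nu) in
     p_integral_basis iota p (Qadjoin theta)
       [tuple 1; theta; (theta ^+ 2 + s%:~R) / q;
              (theta ^+ 3 + s%:~R * theta) / q]).
Proof.
move=> f_sq; split; first exact: quartic_mod_square.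
move=> /(proj1 (quartic_mod_square p_prime p_gt2 a b c)) [].
move=> pb _ ac nsq s s_close.
have pD : (p%:Z %| 4 * c - a ^+ 2)%Z by rewrite -eqz_mod_dvd; apply/eqP.
have [m [A [B [C [floorE aE bE cE [pA max_hyp]]]]]] :=
  order_parameters p_prime p_gt2 pb pD s_close.
move=> nu q; set h : int := (p ^ m)%N%:Z in aE max_hyp.
have h_neq0 : h != 0 by rewrite eqz_nat -lt0n expn_gt0 prime_gt0.
have qE : q = h%:~R.
  by rewrite /q /nu floorE -exprnP -natrX.
have h2E : (p ^ (2 * m))%N%:Z = h ^+ 2.
  by rewrite mulnC expnM expr2 -mulnn PoszM.
rewrite h2E in bE cE; rewrite qE.
pose z : Omega := (theta ^+ 2 + s%:~R) / h%:~R.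
have t2E : theta ^+ 2 = h%:~R * z - s%:~R by exact: (theta_sqrE iota).
have z2E : z ^+ 2 = - (A%:~R * z + B%:~R * theta + C%:~R).
  exact: (z_sqrE iota theta_root h_neq0 aE bE cE).
have s_aniso : anisotropic (s%:~R : 'F_p).
  apply: anisotropic_nonsquare => -[y yE]; apply: nsq; exists y.
  have F2 := two_neq0_Fp p_prime p_gt2.
  (* s = a / 2 modulo p, as p divides A *)
  have /eqP : (a - 2 * s)%:~R == 0 :> 'F_p.
    by rewrite intr_Fp_eq0 // aE dvdz_mull.
  rewrite rmorphB rmorphM /= => /eqP; rewrite subr_eq0 => /eqP ->.
  by rewrite yE; field.
have t_int := theta_integral theta_root.
have z_int : integralOver (intr : int -> Omega) z.
  apply: (@integral_quadratic _ _ A%:~R (B%:~R * theta + C%:~R)).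
  - exact: integral_id.
  - by apply: integral_add; first apply: integral_mul => //; apply: integral_id.
  - by rewrite z2E addrA.
have tz_int : integralOver (intr : int -> Omega) (theta * z).
  exact: integral_mul.
have Kt : Qadjoin theta theta by exact: Qadjoin_id.
have Kz : Qadjoin theta z.
  apply: Qadjoin_div; last exact: Qadjoin_int.
  by apply: Qadjoin_add; [exact: Qadjoin_mul | exact: Qadjoin_int].
have maxO := integral_div_pexp p_prime (two_neq0_Fp p_prime p_gt2) t2E z2E
  (quad_evalZ_inj iota f_irr theta_root h_neq0) t_int z_int s_aniso pA max_hyp.
have sumE (r : 'I_4 -> rat) :
    \sum_(i < 4) iota (r i) *
      tnth [tuple 1; theta; (theta ^+ 2 + s%:~R) / h%:~R;
                  (theta ^+ 3 + s%:~R * theta) / h%:~R] i =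
    quad_eval iota theta z (r (inord 0), r (inord 1), r (inord 2), r (inord 3)).
  rewrite !big_ord_recl big_ord0 !(tnth_nth 0) /= mulr1 addr0 !addrA.
  have -> : (theta ^+ 3 + s%:~R * theta) / h%:~R = theta * z by rewrite /z; ring.
  by congr (iota (r _) + iota (r _) * _ + iota (r _) * _ + iota (r _) * _);
    apply: val_inj; rewrite /= inordK.
split.
- move=> i; have -> : tnth [tuple 1; theta; (theta ^+ 2 + s%:~R) / h%:~R;
      (theta ^+ 3 + s%:~R * theta) / h%:~R] i =
      tnth [tuple 1; theta; z; theta * z] i.
    rewrite !(tnth_nth 0) /=; case: i => [[|[|[|[|i]]]]] //= _.
    by rewrite /z; ring.
  rewrite (tnth_nth 0); case: i => [[|[|[|[|i]]]]] //= _;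
    apply: localized_integersW => //.
  + by have K1 : Qadjoin theta 1%:~R by exact: Qadjoin_int.
  + exact: integral1.
  + exact: Qadjoin_mul.
- move=> x Kx.
  have [r0 [r1 [r2 [r3 [l0 l1 l2 l3 xE]]]]] :=
    localized_quad p_prime maxO (Qadjoin_quad iota f_irr theta_root s h_neq0) Kx.
  exists (nth 0 [:: r0; r1; r2; r3]).
    by case=> [[|[|[|[|i]]]]].
  by rewrite sumE xE !inordK.
- move=> r _; rewrite sumE.
  case/(quad_evalQ_eq0 f_irr theta_root h_neq0) => r0 r1 r2 r3 i.
  by rewrite -[i]inord_val; case: i => [[|[|[|[|i]]]]].
Qed.
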